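(* Let $p$ be a prime, let $a$ be a positive integer, let $d\in\{0,1,\ldots,p^a\}$, and let $m\in\mathbb{Z}$ with $p\nmid m$. Then $$\sum_{k=0}^{p^a-1}\frac{\binom{2k}{k+d}}{m^k}\equiv u_{p^a-d}(m-2)\pmod p,$$ and, provided $d>0$, $$d\sum_{k=1}^{p^a-1}\frac{\binom{2k}{k+d}}{k\,m^{k-1}}\equiv 2(-1)^{d}+v_{p^a-d}(m-2)\pmod p.$$ If moreover $p\neq 2$, then $$\sum_{k=0}^{p^a-1}\frac{\binom{2k}{k+d}}{m^k}\equiv -u_{d-\left(\frac{m(m-4)}{p^a}\right)}(m-2)\pmod p,$$ and also, provided $d>0$, $$d\sum_{k=1}^{p^a-1}\frac{\binom{2k}{k+d}}{k\,m^{k-1}}\equiv 2(-1)^{d}+v_{d-\left(\frac{m(m-4)}{p^a}\right)}(m-2)\pmod p.$$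
   Context: The polynomial sequences $u_n(x)$ and $v_n(x)$ are defined by $u_0(x)=0$, $u_1(x)=1$, $u_{n+1}(x)=x\,u_n(x)-u_{n-1}(x)$ for $n\ge 1$, and $v_0(x)=2$, $v_1(x)=x$, $v_{n+1}(x)=x\,v_n(x)-v_{n-1}(x)$ for $n\ge 1$; also $u_{-1}(x)=x u_0(x)-u_1(x)=-1$ and $v_{-1}(x)=xv_0(x)-v_1(x)=x$. The symbol $\left(\frac{c}{p^a}\right)$ (for $p$ odd) is the Jacobi symbol, with value in $\{0,1,-1\}$ (value $0$ if $p\mid c$). $\binom{n}{k}=0$ if $k>n\ge0$ or $k<0$. Congruences modulo $p$ between rational numbers are understood in the ring of rational numbers whose denominator is prime to $p$. *)

(* Defs.v *)
From HB Require Import structures.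
From mathcomp Require Import all_boot all_order all_algebra.

Set Implicit Arguments.
Unset Strict Implicit.
Unset Printing Implicit Defensive.

Import Order.TTheory GRing.Theory Num.Theory.
Local Open Scope ring_scope.

Fixpoint lucas_rec (w0 w1 : {poly int}) (n : nat) : {poly int} :=
  match n with
  | 0 => w0
  | 1 => w1
  | (n''.+1 as n').+1 => 'X * lucas_rec w0 w1 n' - lucas_rec w0 w1 n''
  end.

(* Negative indices: the recurrence w_(n+1) = x w_n - w_(n-1) is symmetric, so
   n |-> w_(-n) satisfies it too, starting from w_0 and w_(-1) = x w_0 - w_1.
   Negz n stands for the integer -(n+1). *)
Definition lucasz (w0 w1 : {poly int}) (n : int) : {poly int} :=
  match n with
  | Posz n => lucas_rec w0 w1 n
  | Negz n => lucas_rec w0 ('X * w0 - w1) n.+1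
  end.

Definition u (n : int) : {poly int} := lucasz 0 1 n.
Definition v (n : int) : {poly int} := lucasz 2%:P 'X n.

(* Meaningful for q an odd prime only. *)
Definition legendre (c : int) (q : nat) : int :=
  if (q %| c)%Z then 0
  else if [exists x : 'I_q, ((x%:Z) ^+ 2 == c %[mod q])%Z] then 1
  else -1.

(* Meaningful for odd n only; prime_decomp lists the pairs (q, e) such that
   n is the product of the q ^ e. *)
Definition jacobi (c : int) (n : nat) : int :=
  \prod_(f <- prime_decomp n) legendre c f.1 ^+ f.2.

Definition pintegral (p : nat) (x : rat) : bool := coprime p `|denq x|%N.

Definition cong_rat (p : nat) (x y : rat) : Prop :=
  [/\ pintegral p x, pintegral p y
    & exists2 z : rat, pintegral p z & x - y = p%:R * z].

(* Main.v *)
Require Import Defs.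
From HB Require Import structures.
From mathcomp Require Import all_boot all_order all_algebra.
From mathcomp Require Import cyclic finfield ring zify.

Set Implicit Arguments.
Unset Strict Implicit.
Unset Printing Implicit Defensive.

Import Order.TTheory GRing.Theory Num.Theory.
Local Open Scope ring_scope.

(* Let q = p^a and S(d) = sum_(k < q) C(2k, k+d) / m^k, computed modulo p.
   Applying Pascal's rule twice and m^q = m gives
   S(d+1) + S(d-1) = (m-2) S(d) + C(2q, q+d) for d > 0.  The last binomial
   vanishes for 0 < d < q because (1+X)^(2q) = (1+X^q)^2, so n |-> S(q-n)
   follows the recurrence of u_n, with S(q) = 0 and S(q-1) = 1.  Since
   d C(2k, k+d) / k = C(2k-1, k+d-1) - C(2k-1, k+d), the second sum is
   S(d-1) - S(d+1) up to an explicit boundary term, and v_n = u_(n+1) - u_(n-1).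
   For odd p, a matrix t with t^2 = x t - 1 satisfies t^n = u_n t - u_(n-1) and
   (2t - x)^2 = x^2 - 4; raising 2t - x to the power q by Frobenius and using
   Euler's criterion yields u_q and u_(q-1), whence u_(q-d) = - u_(d-eps) by
   uniqueness of solutions of the recurrence. *)

(** * Lucas recurrences indexed by all integers *)

Definition lucas_recurrence (R : pzRingType) (x : R) (f : int -> R) :=
  forall n, f (n + 1) = x * f n - f (n - 1).

(** The recurrence determines its solution in both directions, so each induction carries two
    adjacent values. Later identities between Lucas values are reduced by it to checks at 0 and
    1. *)
Lemma lucas_recurrence_unique (R : pzRingType) (x : R) (f g : int -> R) :
  lucas_recurrence x f -> lucas_recurrence x g ->
  f 0 = g 0 -> f 1 = g 1 -> f =1 g.
Proof.
move=> rf rg e0 e1.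
have back (h : int -> R) : lucas_recurrence x h ->
    forall n, h (n - 1) = x * h n - h (n + 1).
  by move=> rh n; rewrite rh subKr.
have pos (n : nat) : f n = g n /\ f n.+1 = g n.+1.
  elim: n => [//|n [en en1]]; split=> //.
  have := rf n.+1; have := rg n.+1.
  have -> : n.+1%:Z + 1 = n.+2 by lia.
  have -> : n.+1%:Z - 1 = n by lia.
  by rewrite en en1 => -> ->.
have neg (n : nat) : f (- n%:Z) = g (- n%:Z) /\ f (1 - n%:Z) = g (1 - n%:Z).
  elim: n => [|n [en en1]]; first by rewrite subr0 oppr0.
  have -> : 1 - n.+1%:Z = - n%:Z by lia.
  have -> : - n.+1%:Z = - n%:Z - 1 by lia.
  by split=> //; rewrite !back // [- _ + 1]addrC en en1.
by case=> n; [case: (pos n) | case: (neg n.+1)].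
Qed.

Lemma lucasz_recurrence (w0 w1 : {poly int}) :
  lucas_recurrence 'X (lucasz w0 w1).
Proof.
case=> [[|n]|[|n]].
- by rewrite [0 - 1](_ : _ = Negz 0) //= subKr.
- have -> : n.+1%:Z + 1 = n.+2 by lia.
  by have -> : n.+1%:Z - 1 = n by lia.
- by rewrite [Negz 0 - 1](_ : _ = Negz 1) //= subKr.
- have -> : Negz n.+1 + 1 = Negz n by lia.
  have -> : Negz n.+1 - 1 = Negz n.+2 by lia.
  by rewrite /= subKr.
Qed.

Section LucasValues.
Variables (R : comNzRingType) (x : int).

Definition lucas_val (w0 w1 : {poly int}) (n : int) : R := (lucasz w0 w1 n).[x]%:~R.
Local Notation U := (lucas_val 0 1).
Local Notation V := (lucas_val 2%:P 'X).

Lemma lucas_val_recurrence w0 w1 :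
  lucas_recurrence x%:~R (lucas_val w0 w1).
Proof.
move=> n; rewrite /lucas_val lucasz_recurrence !hornerE.
by rewrite rmorphB rmorphM.
Qed.

Lemma u_val0 : U 0 = 0.
Proof. by rewrite /lucas_val /= horner0. Qed.

Lemma u_val1 : U 1 = 1.
Proof. by rewrite /lucas_val /= hornerC. Qed.

Lemma v_val_u n : V n = U (n + 1) - U (n - 1).
Proof.
have ru := lucas_val_recurrence 0 1.
apply: (lucas_recurrence_unique (x := x%:~R) (f := V)
  (g := fun n => U (n + 1) - U (n - 1))) => [|k||].
- exact: lucas_val_recurrence.
- have := ru (k - 1); rewrite (ru (k + 1)) !addrK => ->; ring.
- rewrite [0 - 1](_ : _ = -1) // add0r u_val1 /lucas_val /= !hornerE /=; ring.
- rewrite [1 - 1](_ : _ = 0) // u_val0 (ru 1) u_val1 u_val0.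
  rewrite /lucas_val /= !hornerE; ring.
Qed.

Lemma u_valN n : U (- n) = - U n.
Proof.
have ru := lucas_val_recurrence 0 1.
apply: (lucas_recurrence_unique (x := x%:~R) (f := fun n => U (- n))
  (g := fun n => - U n)) => [k|k||] /=.
- by rewrite opprD opprB [1 - k]addrC ru; ring.
- by rewrite ru; ring.
- by rewrite oppr0 u_val0 oppr0.
- have := ru 0; rewrite add0r u_val1 u_val0 mulr0 => ->.
  by rewrite !sub0r opprK.
Qed.

End LucasValues.

(** * Euler's criterion and Jacobi symbols at prime powers *)

(** Fermat makes [c ^+ h] a square root of 1, equal to 1 when [c] is a square. Conversely, the unit
    group is cyclic of order 2h: if c = z^i and c^h = 1, then 2h divides ih, so i is even and [c] is
    a square. *)
Lemma finField_euler (F : finFieldType) (h : nat) (c : F) :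
  #|F| = h.*2.+1 -> c != 0 ->
  c ^+ h = if [exists y : F, y ^+ 2 == c] then 1 else -1.
Proof.
move=> cardF c0.
have fermat (y : F) : y != 0 -> y ^+ h.*2 = 1.
  move=> y0; apply: (mulfI y0); rewrite mulr1 -exprS -cardF.
  exact: expf_card.
case: existsP => [[y /eqP yc]|nsq].
  have y0 : y != 0 by apply: contraNneq c0 => y0; rewrite -yc y0 expr0n.
  by rewrite -yc -exprM mul2n fermat.
have h2 : (0 < h.*2)%N by have := finNzRing_gt1 F; rewrite cardF; lia.
have /hasP[z _ prim_z] : has (h.*2).-primitive_root (enum (predC1 (0 : F))).
  apply: has_prim_root => //; last 2 first.
  - exact: enum_uniq.
  - by rewrite -cardE cardC1 cardF.
  by apply/allP=> y; rewrite mem_enum inE unity_rootE => /fermat ->.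
have : c ^+ h == 1 \/ c ^+ h == -1.
  by apply/orP; rewrite -sqrf_eq1 -exprM muln2 fermat.
case=> /eqP // ch; case: nsq.
have [[i _] /= ci] := prim_rootP prim_z (fermat _ c0).
have : (h.*2 %| i * h)%N by rewrite (prim_order_dvd prim_z) exprM -ci ch.
rewrite -mul2n dvdn_pmul2r; last by rewrite -double_gt0.
by case/dvdnP=> j ij; exists (z ^+ j); rewrite -exprM -ij ci.
Qed.

Lemma legendre_euler (p : nat) (c : int) :
  prime p -> p != 2 -> (legendre c p)%:~R = c%:~R ^+ p./2 :> 'F_p.
Proof.
move=> pp p2.
have odd_p : odd p by case: (even_prime pp) p2 => [->|].
have pE : p = p./2.*2.+1 by rewrite -{1}(odd_double_half p) odd_p.
have chp := pchar_Fp pp.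
rewrite /legendre (dvdz_pcharf chp).
have [->|c0] := eqVneq (c%:~R : 'F_p) 0.
  by rewrite expr0n gtn_eqF // half_gt0 prime_gt1.
rewrite (finField_euler (h := p./2)) ?card_Fp //.
suff -> : [exists x : 'I_p, (x%:Z ^+ 2 == c %[mod p])%Z]
        = [exists y : 'F_p, y ^+ 2 == c%:~R] by case: ifP.
have sqE (k : nat) : (k%:Z ^+ 2 == c %[mod p])%Z = (k%:R ^+ 2 == c%:~R :> 'F_p).
  by rewrite eqz_mod_dvd (dvdz_pcharf chp) rmorphB rmorphXn /= subr_eq0.
apply/existsP/existsP=> [[k]|[y yc]]; first by rewrite sqE => kc; exists k%:R.
have yp : (val y < p)%N by rewrite -[X in (_ < X)%N](Fp_cast pp) ltn_ord.
by exists (Ordinal yp); rewrite sqE /= natr_Zp.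
Qed.

Lemma jacobi_prime_power (c : int) (p a : nat) :
  prime p -> (0 < a)%N -> jacobi c (p ^ a) = legendre c p ^+ a.
Proof.
move=> pp a0; rewrite /jacobi prime_decompE primesX // primes_prime //=.
by rewrite big_seq1 /= pfactorK.
Qed.

Lemma legendre_val (c : int) (p : nat) : legendre c p \in [:: 0; 1; -1].
Proof. by rewrite /legendre; do 2?case: ifP. Qed.

Lemma jacobi_prime_power_val (c : int) (p a : nat) :
  prime p -> (0 < a)%N -> jacobi c (p ^ a) \in [:: 0; 1; -1].
Proof.
move=> pp a0; rewrite jacobi_prime_power //; have := legendre_val c p.
rewrite !inE => /or3P[] /eqP ->; rewrite ?expr0n ?expr1n ?(gtn_eqF a0) //.
by rewrite -signr_odd; case: odd.
Qed.

(** * From equalities in ['F_p] to congruences between rationals *)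

Lemma pintegral_divz (p : nat) (b c : int) :
  prime p -> ~~ (p %| c)%Z -> pintegral p (b%:~R / c%:~R).
Proof.
move=> pp pc; rewrite /pintegral prime_coprime //.
apply: contra pc => pd; apply: dvdz_trans (pd : (p %| denq _)%Z) _.
have c0 : c%:~R != 0 :> rat.
  by rewrite intr_eq0; apply: contraTneq pd => ->; rewrite invr0 mulr0 Euclid_dvd1.
set x := _ / _.
have : (denq x %| numq x * c)%Z.
  apply/dvdzP; exists b; apply: (@intr_inj rat).
  by rewrite !rmorphM /= numqE /x mulrAC divfK.
by rewrite Gauss_dvdzr // coprimezE coprime_sym coprime_num_den.
Qed.

(** Over [rat] and over ['F_p] alike, the sum is the same integer [b] divided by m^n. Hence the
    equality in ['F_p] says that p divides b - y m^n, and m^n is prime to p. *)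
Lemma cong_rat_sum (p n : nat) (m y : int) (c : nat -> int) :
  prime p -> ~~ (p %| m)%Z ->
  \sum_(0 <= k < n) (c k)%:~R / m%:~R ^+ k = y%:~R :> 'F_p ->
  cong_rat p (\sum_(0 <= k < n) (c k)%:~R / m%:~R ^+ k) y%:~R.
Proof.
move=> pp pm sumE; have chp := pchar_Fp pp.
pose b := \sum_(0 <= k < n) c k * m ^+ (n - k).
have clear (F : fieldType) : m%:~R != 0 :> F ->
    \sum_(0 <= k < n) (c k)%:~R / m%:~R ^+ k = b%:~R / (m ^+ n)%:~R :> F.
  move=> m0; rewrite rmorph_sum mulr_suml; apply: eq_big_nat => k /andP[_ kn].
  rewrite rmorphM !rmorphXn /= -{2}(subnK (ltnW kn)) exprD invfM mulrA mulfK //.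
  exact: expf_neq0.
have pmn : ~~ (p %| m ^+ n)%Z.
  by rewrite (dvdz_pcharf chp) rmorphXn expf_neq0 // -(dvdz_pcharf chp).
have m0 : m%:~R != 0 :> rat.
  by rewrite intr_eq0; apply: contraNneq pm => ->; rewrite dvdz0.
rewrite clear //; split; first exact: pintegral_divz.
  rewrite -[y%:~R]divr1 -[1]/(1%:~R); apply: pintegral_divz => //.
  by rewrite dvdz1 neq_ltn prime_gt1 ?orbT.
have /dvdzP[z bz] : (p %| b - y * m ^+ n)%Z.
  rewrite (dvdz_pcharf chp) rmorphB rmorphM /= -sumE clear.
    by rewrite divfK ?subrr // -(dvdz_pcharf chp).
  by rewrite -(dvdz_pcharf chp).
exists (z%:~R / (m ^+ n)%:~R); first exact: pintegral_divz.
apply/eqP; rewrite mulrA subr_eq -[X in _ + X](@mulfK _ (m ^+ n)%:~R); last first.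
  by rewrite rmorphXn expf_neq0.
rewrite -mulrDl; apply/eqP; congr (_ / _).
by rewrite -[p%:R]/(p%:~R) -!rmorphM -rmorphD /= [_ * z]mulrC -bz subrK.
Qed.

(** * Binomial identities, over the integers and in characteristic p *)

Lemma central_bin_pascal (k d : nat) :
  ('C(2 * k.+1, k.+1 + d.+1) =
   'C(2 * k, k + d.+2) + 2 * 'C(2 * k, k + d.+1) + 'C(2 * k, k + d))%N.
Proof. by rewrite mulnS !addSn !addnS !binS; ring. Qed.

(** This removes the denominator k + 1, which p may divide, so that the second sum acquires integer
    numerators over powers of m and can be reduced modulo p. *)
Lemma bin_frac_pascal (k d : nat) :
  (d * 'C(2 * k.+1, k.+1 + d))%:R / k.+1%:R
  = 'C((2 * k).+1, k + d)%:R - 'C((2 * k).+1, (k + d).+1)%:R :> rat.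
Proof.
have k0 : k.+1%:R != 0 :> rat by rewrite pnatr_eq0.
have -> : 'C(2 * k.+1, k.+1 + d) =
    ('C((2 * k).+1, (k + d).+1) + 'C((2 * k).+1, k + d))%N.
  by rewrite mulnS addSn binS.
have [dk|kd] := leqP d k.+1; last first.
  by rewrite !bin_small ?muln0 ?subrr ?mul0r //; lia.
apply: (mulIf k0); rewrite divfK //.
have := mul_bin_left (2 * k).+1 (k + d).
have -> : ((2 * k).+1 - (k + d) = k.+1 - d)%N by lia.
move: 'C(_, (k + d).+1) 'C(_, k + d) => c1 c0.
move/(congr1 (fun n => n%:R : rat)); rewrite !natrM natrB // => e.
have e1 : c1%:R * k.+1%:R = (k + d).+1%:R * c1%:R - d%:R * c1%:R :> rat.
  rewrite -mulrBl -natrB; last by lia.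
  by rewrite subSn ?leq_addl // addnK mulrC.
rewrite mulrBl e1 e natrD; ring.
Qed.

Section PrimeChar.
Variables (F : fieldType) (p a : nat).
Hypothesis (chF : p \in [pchar F]).
Local Notation q := (p ^ a)%N.

Lemma bin_double_pchar (j : nat) :
  (q < j < 2 * q)%N -> 'C(2 * q, j)%:R = 0 :> F.
Proof.
case/andP=> qj jq.
have -> : 'C(2 * q, j)%:R = (('X + 1) ^+ (2 * q) : {poly F})`_j.
  rewrite exprDn coef_sum; under eq_bigr => i _.
    rewrite expr1n mulr1 coefMn coefXn; over.
  (* In [exprDn] the exponent of ['X] decreases with the index, so the coefficient of X^j sits at
     index 2q - j. *)
  have jlt : (2 * q - j < (2 * q).+1)%N by lia.
  rewrite (bigD1 (Ordinal jlt)) //=.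
  rewrite big1 ?addr0 => [|i /eqP ni].
    by rewrite subKn ?eqxx ?bin_sub //; lia.
  case: eqP => [ji|]; last by rewrite mul0rn.
  by case: ni; apply: val_inj => /=; have := ltn_ord i; lia.
have qn : [pchar {poly F}].-nat q.
  rewrite (eq_pnat _ (pchar_poly _)) pnatX.
  by rewrite (pnatE _ (pcharf_prime chF)) chF.
rewrite mulnC exprM exprDn_pchar // expr1n sqrrD expr1n mulr1 !coefD.
rewrite -exprM !coefXn coef1 (gtn_eqF qj).
have -> : (j == q * 2)%N = false by lia.
have -> : (j == 0)%N = false by lia.
by rewrite !addr0.
Qed.

(** Inner entries of row 2q strictly beyond the middle vanish, so by Pascal's rule adjacent entries
    of row 2q - 1 there are opposite; the last entry of that row is 1. *)
Lemma bin_double_pred_pchar (d : nat) :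
  (0 < d <= q)%N -> 'C((2 * q).-1, (2 * q) - d)%:R = (-1) ^+ d.-1 :> F.
Proof.
case: d => // d; elim: d => [|d IH] dq.
  by rewrite subn1 binn.
have {}IH := IH (ltnW dq).
have : 'C(2 * q, 2 * q - d.+1)%:R = 0 :> F.
  by apply: bin_double_pchar; lia.
have -> : 'C(2 * q, 2 * q - d.+1) =
  ('C((2 * q).-1, 2 * q - d.+1) + 'C((2 * q).-1, 2 * q - d.+2))%N.
  have {1}-> : (2 * q = (2 * q).-1.+1)%N by lia.
  have -> : (2 * q - d.+1 = (2 * q - d.+2).+1)%N by lia.
  by rewrite binS.
rewrite natrD IH => /eqP; rewrite addrC addr_eq0 => /eqP ->.
by rewrite exprS mulN1r.
Qed.

End PrimeChar.

(** * The two central binomial sums as Lucas values *)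

Section CentralSums.
Variables (F : fieldType) (p a : nat) (m : int).
Local Notation q := (p ^ a)%N.
Local Notation mF := (m%:~R : F).
Hypotheses (chF : p \in [pchar F]) (m0 : mF != 0) (mq : mF ^+ q = mF).
Local Notation U := (lucas_val F (m - 2) 0 1).
Local Notation V := (lucas_val F (m - 2) 2%:P 'X).

Let q_gt0 : (0 < q)%N.
Proof. by rewrite expn_gt0 prime_gt0 // (pcharf_prime chF). Qed.

Let S (d : nat) : F := \sum_(0 <= k < q) 'C(2 * k, k + d)%:R / mF ^+ k.

Lemma central_sum_recurrence (d : nat) :
  S d.+2 = (m - 2)%:~R * S d.+1 - S d + 'C(2 * q, q + d.+1)%:R.
Proof.
pose f k : F := 'C(2 * k, k + d.+1)%:R / mF ^+ k.
(* No term is lost at the bottom, since C(0, d+1) = 0. The new top term [f q] becomes the bare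
   binomial after multiplication by m, because m^q = m. *)
have shift : \sum_(0 <= k < q) f k.+1 = S d.+1 + f q.
  rewrite [RHS](_ : _ = \sum_(0 <= k < q.+1) f k); last by rewrite big_nat_recr.
  by rewrite big_nat_recl // [f 0%N]mul0r add0r.
have : mF * \sum_(0 <= k < q) f k.+1 = S d.+2 + 2 * S d.+1 + S d.
  rewrite !mulr_sumr -!big_split; apply: eq_bigr => k _ /=.
  rewrite /f central_bin_pascal exprS !natrD.
  by field; rewrite expf_neq0.
rewrite shift /f mq rmorphB /= => e.
rewrite -[S d.+2](addrK (2 * S d.+1 + S d)) addrA -e; field.
exact: m0.
Qed.

Lemma central_sum_u (d : nat) : (d <= q)%N -> S d = U (q%:Z - d%:Z).
Proof.
have Sq e : (q <= e)%N -> S e = 0.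
  move=> qe; rewrite /S big_nat_cond big1 // => k /andP[/andP[_ kq] _].
  by rewrite bin_small ?mul0r //; lia.
suff main n : (n < q)%N ->
    S (q - n)%N = U n%:Z /\ S (q - n.+1)%N = U n.+1%:Z.
  move=> dq; case: (ltnP 0 d) => [d0|].
    have [] := main (q - d)%N; first by lia.
    by rewrite subKn // => -> _; congr (U _); lia.
  rewrite leqn0 => /eqP ->; have [] := main q.-1; first by lia.
  by move=> _; rewrite prednK // subnn subr0.
elim: n => [|n IH] nq.
  rewrite subn0 u_val0 u_val1 Sq //; split=> //.
  (* Here the extra binomial is C(2q, 2q) = 1 while S(q) = S(q+1) = 0, which forces S(q-1) = 1. *)
  have := central_sum_recurrence (q - 1).
  rewrite (Sq (q - 1).+2) ?(Sq (q - 1).+1); try lia.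
  rewrite mulr0 sub0r.
  have -> : (q + (q - 1).+1 = 2 * q)%N by lia.
  by rewrite binn addrC => /eqP; rewrite eq_sym subr_eq0 => /eqP <-.
have [e0 e1] := IH (ltnW nq); split=> //.
have := central_sum_recurrence (q - n.+2).
have -> : ((q - n.+2).+2 = q - n)%N by lia.
have -> : ((q - n.+2).+1 = q - n.+1)%N by lia.
rewrite e0 e1 (bin_double_pchar chF) ?addr0 => [e|]; last by lia.
have := lucas_val_recurrence F (m - 2) 0 1 n.+1.
have -> : n.+1%:Z + 1 = n.+2 by lia.
have -> : n.+1%:Z - 1 = n by lia.
by rewrite e subKr.
Qed.

(** Extended to k = q - 1, the sum is S(d-1) - S(d+1), a value of [V]; the added top term is
    -2(-1)^d. *)
Lemma central_diff_sum_v (d : nat) : (0 < d <= q)%N ->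
  \sum_(0 <= k < q.-1)
    ('C((2 * k).+1, k + d)%:R - 'C((2 * k).+1, (k + d).+1)%:R) / mF ^+ k
  = 2 * (-1) ^+ d + V (q%:Z - d%:Z).
Proof.
(* Frobenius is additive, so this also covers p = 2. *)
have signq : (-1) ^+ q = -1 :> F.
  elim: (a) => [|b IH]; first by rewrite expr1.
  rewrite expnSr exprM IH -(pFrobenius_autE chF) pFrobenius_autN.
  by rewrite pFrobenius_aut1.
(* The case d = q is separate, since S(q+1) is outside the range of [central_sum_u]: all terms
   vanish, and so does the right side, -2 + [V 0]. *)
case: d => // d; rewrite /= leq_eqVlt => /predU1P[dq|dq].
  rewrite dq signq subrr [V 0]/lucas_val /= hornerC.
  rewrite big_nat_cond big1 ?mulrN1 ?addNr // => k /andP[/andP[_ kq] _].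
  by rewrite !bin_small ?subrr ?mul0r //; lia.
pose f k : F :=
  ('C((2 * k).+1, k + d.+1)%:R - 'C((2 * k).+1, (k + d.+1).+1)%:R) / mF ^+ k.
have fq : f q.-1 = - (2 * (-1) ^+ d.+1).
  have -> : f q.-1 = ('C((2 * q).-1, 2 * q - (q - d))%:R
                      - 'C((2 * q).-1, 2 * q - (q - d.+1))%:R).
    rewrite /f (_ : mF ^+ q.-1 = 1) ?divr1.
      by congr ('C(_, _)%:R - 'C(_, _)%:R); lia.
    by apply: (mulfI m0); rewrite -exprS prednK ?mulr1.
  rewrite !(bin_double_pred_pchar chF); try lia.
  have e : (-1) ^+ (q - d.+1) = - (-1) ^+ d.+1 :> F.
    apply: (mulIf (x := (-1) ^+ d.+1)); first by rewrite signr_eq0.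
    by rewrite -exprD subnK 1?ltnW // signq mulNr -expr2 sqrr_sign.
  rewrite -subnS e.
  have -> : (q - d.+1).-1 = (q - d.+2)%N by lia.
  have : (-1) ^+ (q - d.+1) = - (-1) ^+ (q - d.+2) :> F.
    by rewrite -[in LHS](subnSK dq) exprS mulN1r.
  by rewrite e => /oppr_inj <-; ring.
have total : \sum_(0 <= k < q) f k = V (q%:Z - d.+1%:Z).
  rewrite v_val_u (_ : _ + 1 = q%:Z - d%:Z); last by lia.
  rewrite (_ : _ - 1 = q%:Z - d.+2%:Z); last by lia.
  rewrite -!central_sum_u; try lia.
  rewrite -sumrB; apply: eq_bigr => k _.
  by rewrite -mulrBl /f !addnS !binS !natrD; congr (_ / _); ring.
rewrite -total -[in RHS](prednK q_gt0) big_nat_recr //= fq.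
by rewrite addrCA subrr addr0.
Qed.

End CentralSums.

(** * Lucas values at prime powers, via Frobenius on a matrix *)

Section LucasFrobenius.
Variables (F : fieldType) (p a : nat) (x : int).
Local Notation q := (p ^ a)%N.
Local Notation xF := (x%:~R : F).
Local Notation U := (lucas_val F x 0 1).
Hypothesis chF : p \in [pchar F].

Lemma lucas_pow (A : algType F) (t : A) (n : nat) :
  t * t = xF *: t - 1 -> t ^+ n = U n *: t - (U (n%:Z - 1))%:A.
Proof.
move=> tt; elim: n => [|n IH].
  by rewrite sub0r u_valN u_val0 u_val1 scale0r scaleN1r opprK add0r.
rewrite exprSr IH mulrBl -!scalerAl tt mul1r scalerBr scalerA.
have -> : n.+1%:Z - 1 = n by lia.
have := lucas_val_recurrence F x 0 1 n.
have -> : n%:Z + 1 = n.+1 by lia.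
by move=> ->; rewrite scalerBl [xF * _]mulrC addrAC.
Qed.

(** [A] may be noncommutative, but scalars are central, so Frobenius is additive on this difference;
    it fixes 2 and x as images of integers. *)
Lemma frobenius_sub_scalar (A : algType F) (t : A) :
  (2 *: t - xF%:A) ^+ q = 2 *: t ^+ q - xF%:A.
Proof.
have chA : p \in [pchar A] by rewrite pchar_lalg.
elim: (a) => [|b IH]; first by rewrite !expr1.
rewrite expnSr exprM IH -(pFrobenius_autE chA) pFrobenius_autB_comm; last first.
  by rewrite /GRing.comm mulr_algl mulr_algr.
rewrite !pFrobenius_autE !exprZn expr1n -exprM.
by rewrite -!(pFrobenius_autE chF) pFrobenius_aut_int pFrobenius_aut_nat.
Qed.

(** The companion matrix of T^2 - x T + 1. It stands in for a root of this polynomial and remains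
    linearly independent of the identity even if the polynomial splits or has a double root, so
    coefficients can be compared. *)
Definition lucas_mx : 'M[F]_2 :=
  \matrix_(i, j) if i == 0 then if j == 0 then xF else -1
                 else if j == 0 then 1 else 0.

Lemma lucas_mx_sqr : lucas_mx * lucas_mx = xF *: lucas_mx - 1.
Proof.
apply/matrixP=> i j; rewrite !mxE !big_ord_recl big_ord0 !mxE /=.
case: i => [[|[|//]]] ?; case: j => [[|[|//]]] ? /=.
all: by rewrite ?mulr1n ?mulr0n; ring.
Qed.

Lemma u_pchar (e : int) :
  odd p -> ((x ^+ 2 - 4)%:~R ^+ p./2) = e%:~R :> F ->
  2 * U q = 2 * (e ^+ a)%:~R /\ 2 * U (q%:Z - 1) = xF * ((e ^+ a)%:~R - 1).
Proof.
move=> odd_p disc.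
(* [N] is a square root of the discriminant, so N^p = disc^((p-1)/2) N = e N, and iterating gives
   N^q = e^a N. *)
pose N := 2 *: lucas_mx - xF%:A.
have NN : N ^+ 2 = ((x ^+ 2 - 4)%:~R : F)%:A.
  have : N ^+ 2 = 4 *: (lucas_mx * lucas_mx) - (4 * xF) *: lucas_mx
                  + (xF ^+ 2)%:A.
    rewrite expr2 /N mulrBl !mulrBr -!scalerAl -!scalerAr !mul1r !mulr1 !scalerA.
    rewrite -[in RHS](_ : 2 * xF + xF * 2 = 4 * xF); last by ring.
    rewrite -[4 in RHS](_ : 2 * 2 = 4); last by ring.
    by rewrite scalerDl -expr2 opprB opprD !addrA addrAC.
  rewrite lucas_mx_sqr => ->; rewrite scalerBr scalerA (addrAC (_ *: _)) subrr add0r.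
  by rewrite rmorphB rmorphXn /= scalerBl addrC.
have Np : N ^+ p = e%:~R *: N.
  rewrite -{1}(odd_double_half p) odd_p -mul2n exprS exprM NN exprZn expr1n.
  by rewrite disc -scalerAr mulr1.
have Nq : N ^+ q = (e ^+ a)%:~R *: N.
  elim: (a) => [|b IH]; first by rewrite expr1 scale1r.
  rewrite expnSr exprM IH exprZn Np scalerA -(pFrobenius_autE chF).
  by rewrite pFrobenius_aut_int -rmorphM -exprSr.
move: Nq; rewrite frobenius_sub_scalar (lucas_pow _ lucas_mx_sqr) => /matrixP Nq.
(* Entry (1, 0) isolates [U q]; entry (0, 0) then gives [U (q - 1)]. *)
have := Nq 1 0; have := Nq 0 0; rewrite !mxE /= !mulr1n !mulr0n.
rewrite !mulr0 !subr0 !mulr1 => e00 e10; split; first by rewrite e10 mulrC.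
have -> : 2 * U (q%:Z - 1) =
    2 * U q * xF - xF - (2 * (U q * xF - U (q%:Z - 1)) - xF) by ring.
by rewrite e00 e10; ring.
Qed.

End LucasFrobenius.

(** * Reflection of the index *)

(** The recurrence is invariant under reversing the index, so both sides of the identity for u solve
    it in k and need only agree at k = 0 and k = 1. In v_n = u_(n+1) - u_(n-1) the reversal swaps
    the two terms, which cancels the sign. *)
Lemma lucas_reflection (F : fieldType) (x : int) (n eps : int) :
  2 != 0 :> F -> eps \in [:: 0; 1; -1] -> (eps = 0 -> x%:~R = 2 :> F) ->
  2 * lucas_val F x 0 1 n = 2 * eps%:~R ->
  2 * lucas_val F x 0 1 (n - 1) = x%:~R * (eps%:~R - 1) ->
  forall k,
    lucas_val F x 0 1 (n - k) = - lucas_val F x 0 1 (k - eps) /\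
    lucas_val F x 2%:P 'X (n - k) = lucas_val F x 2%:P 'X (k - eps).
Proof.
move=> two0 eps_val eps0 /(mulfI two0) Un Un1.
set U := lucas_val F x 0 1 in Un Un1 *.
have ru : lucas_recurrence x%:~R U := lucas_val_recurrence F x 0 1.
have U0 : U 0 = 0 := u_val0 F x.
have U1 : U 1 = 1 := u_val1 F x.
have Ueps : U eps = eps%:~R.
  move: eps_val; rewrite !inE => /or3P[] /eqP-> //.
  by rewrite [U _]u_valN [lucas_val _ _ _ _ _]U1.
(* For eps = 0 the two sides are -x/2 and -1, whence the assumption x = 2 in that case. *)
have U1eps : U (n - 1) = - U (1 - eps).
  apply: (mulfI two0); rewrite Un1.
  move: eps_val eps0; rewrite !inE => /or3P[] /eqP->.
  - by move/(_ erefl) ->; rewrite subr0 U1; ring.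
  - by move=> _; rewrite !subrr U0 oppr0 !mulr0.
  - by move=> _; rewrite opprK (ru 1) subrr U0 U1; ring.
have main : (fun k => U (n - k)) =1 (fun k => - U (k - eps)).
  apply: (lucas_recurrence_unique (x := x%:~R)) => [k|k||].
  - have := ru (n - k).
    rewrite (_ : n - (k + 1) = n - k - 1); last by ring.
    rewrite (_ : n - (k - 1) = n - k + 1); last by ring.
    by move=> ->; rewrite subKr.
  - rewrite (_ : k + 1 - eps = k - eps + 1); last by ring.
    rewrite (_ : k - 1 - eps = k - eps - 1); last by ring.
    by rewrite ru; ring.
  - by rewrite subr0 sub0r [U (- _)]u_valN opprK -/U Ueps.
  - exact: U1eps.
move=> k; split; first exact: main.
rewrite !v_val_u -/U.
have := main (k - 1); rewrite (_ : n - (k - 1) = n - k + 1); last by ring.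
have := main (k + 1); rewrite (_ : n - (k + 1) = n - k - 1); last by ring.
move=> -> ->.
rewrite (_ : k + 1 - eps = k - eps + 1); last by ring.
rewrite (_ : k - 1 - eps = k - eps - 1); last by ring.
by rewrite opprK addrC.
Qed.

Theorem theorem1p1 (p a d : nat) (m : int)
    (hp : prime p) (ha : (0 < a)%N) (hd : (d <= p ^ a)%N)
    (hm : ~~ (p %| m)%Z) :
  [/\ cong_rat p
        (\sum_(0 <= k < (p ^ a)%N) 'C(2 * k, k + d)%:R / m%:~R ^+ k)
        ((u ((p ^ a)%N%:Z - d%:Z)).[m - 2])%:~R,
      (0 < d)%N ->
      cong_rat p
        (d%:R * \sum_(1 <= k < (p ^ a)%N)
                   'C(2 * k, k + d)%:R / (k%:R * m%:~R ^+ (k - 1)))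
        (2 * (-1) ^+ d + (v ((p ^ a)%N%:Z - d%:Z)).[m - 2])%:~R
    & p <> 2%N ->
      cong_rat p
        (\sum_(0 <= k < (p ^ a)%N) 'C(2 * k, k + d)%:R / m%:~R ^+ k)
        (- (u (d%:Z - jacobi (m * (m - 4)) (p ^ a))).[m - 2])%:~R
      /\ ((0 < d)%N ->
          cong_rat p
            (d%:R * \sum_(1 <= k < (p ^ a)%N)
                       'C(2 * k, k + d)%:R / (k%:R * m%:~R ^+ (k - 1)))
            (2 * (-1) ^+ d
             + (v (d%:Z - jacobi (m * (m - 4)) (p ^ a))).[m - 2])%:~R)].
Proof.
have chF := pchar_Fp hp.
have m0 : m%:~R != 0 :> 'F_p by rewrite -(dvdz_pcharf chF).
have mq : m%:~R ^+ (p ^ a) = m%:~R :> 'F_p.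
  elim: (a) => [|b IH]; first by rewrite expr1.
  by rewrite expnSr exprM IH -(pFrobenius_autE chF) pFrobenius_aut_int.
have sum_u (y : int) : lucas_val 'F_p (m - 2) 0 1 ((p ^ a)%N%:Z - d%:Z) = y%:~R ->
    cong_rat p
      (\sum_(0 <= k < (p ^ a)%N) 'C(2 * k, k + d)%:R / m%:~R ^+ k) y%:~R.
  rewrite -(central_sum_u chF m0 mq hd).
  exact: (cong_rat_sum (c := fun k => 'C(2 * k, k + d)%:Z) hp hm).
have sum_v (y : int) : (0 < d)%N ->
    lucas_val 'F_p (m - 2) 2%:P 'X ((p ^ a)%N%:Z - d%:Z) = y%:~R ->
    cong_rat p
      (d%:R * \sum_(1 <= k < (p ^ a)%N)
                 'C(2 * k, k + d)%:R / (k%:R * m%:~R ^+ (k - 1)))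
      (2 * (-1) ^+ d + y)%:~R.
  move=> d0 vy.
  (* Numerators after the shift from k to k + 1, which turns the range 1..q-1 into 0..q-2 and
     m^(k-1) into m^k. *)
  pose c k := 'C((2 * k).+1, k + d)%:Z - 'C((2 * k).+1, (k + d).+1)%:Z.
  rewrite (_ : d%:R * _ = \sum_(0 <= k < (p ^ a).-1) (c k)%:~R / m%:~R ^+ k).
    apply: cong_rat_sum => //.
    under eq_bigr => k _ do rewrite rmorphB /=.
    rewrite (central_diff_sum_v chF) ?d0 // vy.
    by rewrite rmorphD rmorphM rmorphXn rmorphN1.
  rewrite mulr_sumr big_add1; apply: eq_bigr => k _.
  rewrite rmorphB /= -bin_frac_pascal subn1 /= natrM invfM.
  by rewrite !mulrA.
split; [exact: sum_u | by move=> d0; apply: sum_v|].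
move=> p2; have odd_p : odd p by case: (even_prime hp).
have two0 : 2 != 0 :> 'F_p.
  by rewrite -(dvdn_pcharf chF) dvdn_prime2 //; apply/eqP.
have disc : (m - 2) ^+ 2 - 4 = m * (m - 4) by ring.
have euler : ((m - 2) ^+ 2 - 4)%:~R ^+ p./2
           = (legendre (m * (m - 4)) p)%:~R :> 'F_p.
  by rewrite disc legendre_euler //; apply/eqP.
have [uq uq1] := u_pchar a chF odd_p euler.
rewrite -jacobi_prime_power // in uq uq1.
(* A zero symbol means that p divides m(m-4); as p does not divide m, m is 4 modulo p. *)
have eps0 : jacobi (m * (m - 4)) (p ^ a) = 0 -> (m - 2)%:~R = 2 :> 'F_p.
  rewrite jacobi_prime_power // => /eqP; rewrite expf_eq0 ha /= => /eqP leg0.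
  move: euler; rewrite leg0 disc => /eqP.
  rewrite expf_eq0 rmorphM mulf_eq0 (negPf m0) /= => /andP[_].
  rewrite !rmorphB /= subr_eq0 => /eqP ->; ring.
have eps_val := jacobi_prime_power_val (m * (m - 4)) hp ha.
have [ud vd] := lucas_reflection two0 eps_val eps0 uq uq1 d.
split; first by apply: sum_u; rewrite ud rmorphN.
by move=> d0; apply: sum_v.
Qed.
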